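(* Let $\mathcal{M},\mathcal{N}$ be von Neumann algebras and let $\Phi_i,\Psi_i\in\mathrm{CP}(\mathcal{M},\mathcal{N})$ for $i=1,2$. Then \[ (\Phi_1\#\Psi_1)+(\Phi_2\#\Psi_2)\le_{\mathrm{cp}}(\Phi_1+\Phi_2)\#(\Psi_1+\Psi_2). \]
   Context: $\mathrm{CP}(\mathcal{M},\mathcal{N})$ is the set of all completely positive (CP) maps $\mathcal{M}\to\mathcal{N}$ (not assumed normal). $\Phi\le_{\mathrm{cp}}\Psi$ means $\Psi-\Phi$ is CP. Forms: for a complex vector space $\mathcal{V}$, $F_+(\mathcal{V})$ is the set of positive sesquilinear forms on $\mathcal{V}$ (linear in the first variable). A compatible representation of $\alpha,\beta\in F_+(\mathcal{V})$ consists of a linear map $h$ from $\mathcal{V}$ onto a dense subspace of a Hilbert space $\mathcal{H}$ and commuting positive $A,B\in\mathbb{B}(\mathcal{H})$ with $\alpha(x,y)=\langle Ah(x),h(y)\rangle$, $\beta(x,y)=\langle Bh(x),h(y)\rangle$. By Pusz–Woronowicz such representations always exist, and for a homogeneous locally bounded Borel function $f$ on $[0,\infty)^2$ the form $f(\alpha,\beta)(x,y):=\langle f(A,B)h(x),h(y)\rangle$ does not depend on the choice. The geometric mean is $\alpha\#\beta:=f(\alpha,\beta)$ with $f(r,s)=\sqrt{rs}$. CP maps: $L^2(\mathcal{N})$ is the standard form Hilbert space of $\mathcal{N}$. For $\Phi\in\mathrm{CP}(\mathcal{M},\mathcal{N})$, $s_\Phi$ is the positive sesquilinear form on the algebraic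 tensor product $\mathcal{M}\odot L^2(\mathcal{N})$ given by $s_\Phi(x\otimes\xi,y\otimes\eta)=\langle\Phi(y^*x)\xi,\eta\rangle$. The geometric mean $\Phi\#\Psi\in\mathrm{CP}(\mathcal{M},\mathcal{N})$ is the unique CP map with $\langle(\Phi\#\Psi)(y^*x)\xi,\eta\rangle=(s_\Phi\#s_\Psi)(x\otimes\xi,y\otimes\eta)$ for all $x,y\in\mathcal{M}$, $\xi,\eta\in L^2(\mathcal{N})$. *)

(* Defs.v *)
From HB Require Import structures.
From mathcomp Require Import all_boot all_order all_algebra.
From mathcomp Require Import sesquilinear complex.
From mathcomp Require Import all_classical all_reals all_analysis.

Set Implicit Arguments.
Unset Strict Implicit.
Unset Printing Implicit Defensive.

Import Order.TTheory GRing.Theory Num.Theory.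
Import numFieldNormedType.Exports.

Local Open Scope classical_set_scope.
Local Open Scope ring_scope.

(* Complex Hilbert spaces; the inner product is linear in its first variable. *)
HB.mixin Record isHilbert (R : realType) H of CompleteNormedModule R[i] H := {
  hdot : {dot H for (@Num.conj R[i])} ;
  hdot_norm : forall x : H, hdot x x = `|x| ^+ 2
}.

#[short(type="hilbertType")]
HB.structure Definition Hilbert (R : realType) :=
  {H of CompleteNormedModule R[i] H & isHilbert R H}.

Section Operators.
Context {R : realType} {H : hilbertType R}.
Implicit Types (T A B : H -> H) (S : set (H -> H)).

Definition bounded_op T := linear T /\ continuous T.

Definition positive_op T := bounded_op T /\ forall x : H, 0 <= hdot (T x) x.

Definition commutant S : set (H -> H) :=
  [set T | bounded_op T /\ forall A, S A -> T \o A = A \o T].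

End Operators.

Section BorelCalculus.
Context {R : realType} {H : hilbertType R}.
Implicit Types (f g : R * R -> R) (A B : H -> H).

Definition quadrant : set (R * R) := [set p | 0 <= p.1 /\ 0 <= p.2].

Definition borel_locally_bounded f :=
  measurable_fun quadrant f /\
  forall c : R, exists K : R, forall p, quadrant p ->
    p.1 <= c -> p.2 <= c -> `|f p| <= K.

(* F is the functional calculus f |-> f(A, B): the *-homomorphism defined on
   the locally bounded Borel functions on [0, +oo)^2 that sends the two
   coordinates to A and B and is continuous along pointwise convergent,
   uniformly locally bounded sequences.  By the spectral theorem it exists
   and is unique for all commuting positive A and B (on the
   functions of that class).  Only real-valued functions are considered, so
   that compatibility with the involution means that F f is self-adjoint.
   Functions that agree on the quadrant have the same image: use
   borel_calculus_cvg with a constant sequence. *)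
Record borel_calculus A B (F : (R * R -> R) -> H -> H) : Prop := {
  borel_calculus_bounded : forall f, borel_locally_bounded f ->
    bounded_op (F f) ;
  borel_calculus_selfadjoint : forall f, borel_locally_bounded f ->
    forall x y, hdot (F f x) y = hdot x (F f y) ;
  borel_calculus1 : F (fun=> 1) = id ;
  borel_calculusD : forall f g,
    borel_locally_bounded f -> borel_locally_bounded g ->
    F (fun p => f p + g p) = (fun x => F f x + F g x) ;
  borel_calculusZ : forall (a : R) f, borel_locally_bounded f ->
    F (fun p => a * f p) = (fun x => a%:C%C *: F f x) ;
  borel_calculusM : forall f g,
    borel_locally_bounded f -> borel_locally_bounded g ->
    F (fun p => f p * g p) = F f \o F g ;
  borel_calculus_fst : F fst = A ;
  borel_calculus_snd : F snd = B ;
  borel_calculus_cvg : forall (u : nat -> R * R -> R) f,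
    (forall n, borel_locally_bounded (u n)) -> borel_locally_bounded f ->
    (forall c : R, exists K : R, forall n p, quadrant p ->
       p.1 <= c -> p.2 <= c -> `|u n p| <= K) ->
    (forall p, quadrant p -> u n p @[n --> \oo] --> f p) ->
    forall x : H, F (u n) x @[n --> \oo] --> F f x
}.

End BorelCalculus.

Section Forms.
Context {R : realType} {V : lmodType R[i]}.
Implicit Types (alpha beta gamma : V -> V -> R[i]).

Definition positive_form alpha :=
  bilinear_for *%R ((@Num.conj R[i]) \; *%R) alpha /\
  forall x, 0 <= alpha x x.

Record compatible_representation alpha beta (H : hilbertType R)
    (h : {linear V -> H}) (A B : H -> H) : Prop := {
  compatible_dense : dense (range h) ;
  compatible_posl : positive_op A ;
  compatible_posr : positive_op B ;
  compatible_comm : A \o B = B \o A ;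
  compatible_forml : forall x y, alpha x y = hdot (A (h x)) (h y) ;
  compatible_formr : forall x y, beta x y = hdot (B (h x)) (h y)
}.

(* gamma = f(alpha, beta); meant for homogeneous f, for which gamma does not
   depend on the representation. *)
Definition form_calculus (f : R * R -> R) alpha beta gamma :=
  exists (H : hilbertType R) (h : {linear V -> H}) (A B : H -> H)
         (F : (R * R -> R) -> H -> H),
    [/\ compatible_representation alpha beta h A B,
        borel_calculus A B F &
        forall x y, gamma x y = hdot (F f (h x)) (h y)].

Definition form_gmean := form_calculus (fun p => Num.sqrt (p.1 * p.2)).

End Forms.

(* An algebraic tensor product of U and V: a vector space with a universal
   bilinear map. *)
Record alg_tensor (K : fieldType) (U V : lmodType K) := AlgTensor {
  alg_tensor_space :> lmodType K ;
  tensor : {bilinear U -> V -> alg_tensor_space} ;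
  tensor_lift : forall (W : lmodType K) (b : {bilinear U -> V -> W}),
    exists f : {linear alg_tensor_space -> W},
      forall u v, f (tensor u v) = b u v ;
  tensor_ext : forall (W : lmodType K) (f g : {linear alg_tensor_space -> W}),
    (forall u v, f (tensor u v) = g (tensor u v)) -> f =1 g
}.

(* Unital complex *-algebras.  The product is not inherited from algType, whose
   elements satisfy 1 != 0: the zero von Neumann algebra is not excluded. *)
HB.mixin Record isStarAlgebra (R : realType) A of GRing.Lmodule R[i] A := {
  salg1 : A ;
  salg_mul : A -> A -> A ;
  star : A -> A ;
  salg_mulA : associative salg_mul ;
  salg_mul1l : left_id salg1 salg_mul ;
  salg_mul1r : right_id salg1 salg_mul ;
  salg_mull : forall (a : R[i]) (x y z : A),
    salg_mul (a *: x + y) z = a *: salg_mul x z + salg_mul y z ;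
  salg_mulr : forall (a : R[i]) (x y z : A),
    salg_mul z (a *: x + y) = a *: salg_mul z x + salg_mul z y ;
  starK : involutive star ;
  star_antilinear : forall (a : R[i]) (x y : A),
    star (a *: x + y) = Num.conj a *: star x + star y ;
  starM : forall x y : A, star (salg_mul x y) = salg_mul (star y) (star x)
}.

#[short(type="starAlgebraType")]
HB.structure Definition StarAlgebra (R : realType) :=
  {A of GRing.Lmodule R[i] A & isStarAlgebra R A}.

Notation "x ** y" := (salg_mul x y) (at level 40, left associativity).

(* A faithful unital *-representation whose image is equal to its bicommutant,
   i.e. is a von Neumann algebra of operators. *)
Record von_neumann_rep (R : realType) (A : starAlgebraType R)
    (H : hilbertType R) (rho : A -> H -> H) : Prop := {
  vnrep_bounded : forall a, bounded_op (rho a) ;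
  vnrep_linear : forall (c : R[i]) a b x,
    rho (c *: a + b) x = c *: rho a x + rho b x ;
  vnrep1 : rho salg1 = id ;
  vnrepM : forall a b, rho (a ** b) = rho a \o rho b ;
  vnrep_star : forall a x y, hdot (rho (star a) x) y = hdot x (rho a y) ;
  vnrep_inj : injective rho ;
  vnrep_bicommutant : commutant (commutant (range rho)) = range rho
}.

HB.mixin Record isVonNeumann (R : realType) A of StarAlgebra R A := {
  von_neumann_subproof :
    exists (H : hilbertType R) (rho : A -> H -> H), von_neumann_rep rho
}.

#[short(type="vonNeumannType")]
HB.structure Definition VonNeumann (R : realType) :=
  {A of StarAlgebra R A & isVonNeumann R A}.

(* Haagerup's standard form (N, L^2(N), J, P); it is unique up to unitary
   equivalence. *)
Record standard_form (R : realType) (N : vonNeumannType R) := StandardForm {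
  L2_space :> hilbertType R ;
  L2_rep : N -> L2_space -> L2_space ;
  L2_J : L2_space -> L2_space ;
  L2_cone : set L2_space ;
  L2_von_neumann_rep : von_neumann_rep L2_rep ;
  L2_JK : involutive L2_J ;
  L2_J_antilinear : forall (a : R[i]) x y,
    L2_J (a *: x + y) = Num.conj a *: L2_J x + L2_J y ;
  L2_J_antiunitary : forall x y, hdot (L2_J x) (L2_J y) = hdot y x ;
  L2_cone_selfdual : L2_cone = [set x | forall y, L2_cone y -> 0 <= hdot x y] ;
  L2_J_commutant :
    [set L2_J \o T \o L2_J | T in range L2_rep] = commutant (range L2_rep) ;
  L2_J_center : forall z : N, (forall a : N, z ** a = a ** z) ->
    L2_J \o L2_rep z \o L2_J = L2_rep (star z) ;
  L2_J_cone : forall x, L2_cone x -> L2_J x = x ;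
  L2_cone_stable : forall (a : N) x, L2_cone x ->
    L2_cone (L2_rep a (L2_J (L2_rep a (L2_J x))))
}.

Section CompletelyPositive.
Context {R : realType}.

(* X = Y^* Y in the *-algebra M_n(A). *)
Definition positive_mx (A : starAlgebraType R) n (X : 'M[A]_n) :=
  exists Y : 'M[A]_n, X = \matrix_(i, j) \sum_k (star (Y k i) ** Y k j).

Definition completely_positive (M N : vonNeumannType R)
    (Phi : {linear M -> N}) :=
  forall n (X : 'M[M]_n), positive_mx X -> positive_mx (map_mx Phi X).

Definition le_cp (M N : vonNeumannType R) (Phi Psi : {linear M -> N}) :=
  completely_positive (Psi \- Phi).

End CompletelyPositive.

Section GeometricMean.
Context {R : realType} {M N : vonNeumannType R} {L2 : standard_form N}.
Variable T : alg_tensor M L2.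
Implicit Types (Phi Psi Theta : {linear M -> N}) (s t g : T -> T -> R[i]).

(* s = s_Phi *)
Definition is_cp_form Phi s :=
  positive_form s /\
  forall (x y : M) (xi eta : L2),
    s (tensor T x xi) (tensor T y eta) =
    hdot (L2_rep (Phi (star y ** x)) xi) eta.

(* Theta = Phi # Psi *)
Definition is_cp_gmean Phi Psi Theta :=
  completely_positive Theta /\
  exists s t g,
    [/\ is_cp_form Phi s, is_cp_form Psi t, form_gmean s t g &
        forall (x y : M) (xi eta : L2),
          hdot (L2_rep (Theta (star y ** x)) xi) eta =
          g (tensor T x xi) (tensor T y eta)].

End GeometricMean.

(* Main.v *)
(* A positive matrix over N is detected by the vectors of L^2(N)^n: if the
   quadratic form of an operator matrix D is positive, its square root (the
   limit of R_{k+1} = (U + R_k^2) / 2, with D proportional to 1 - U) commutes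
   with the diagonal action of the commutant of N, so that its entries lie in
   N by the bicommutant property.  This reduces the theorem to the
   superadditivity of the geometric mean of positive forms.

   The set of the functions f for which f(alpha, beta) is superadditive
   contains the two coordinates and is closed under sums, nonnegative multiples
   and bounded pointwise limits.  It is also closed under parallel sums
   f g / (f + g): the value of the parallel sum of two forms at x is the
   infimum of f(v, v) + g(x - v, x - v) over v, by completing the square.  The
   arithmetic-harmonic mean iteration, whose limit is sqrt (r s), thus stays in
   that set. *)

From HB Require Import structures.
Require Import Defs.
From mathcomp Require Import all_boot all_order all_algebra.
From mathcomp Require Import sesquilinear complex ring lra.
From mathcomp Require Import all_classical all_reals all_analysis.
From mathcomp Require Import measurable_realfun.
Set Implicit Arguments.
Unset Strict Implicit.
Unset Printing Implicit Defensive.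
Import Order.TTheory GRing.Theory Num.Theory.
Import numFieldNormedType.Exports.
Local Open Scope classical_set_scope.
Local Open Scope ring_scope.

(** * Sesquilinear forms and Hilbert spaces *)

Section LinearFunctions.
Context {K : nzRingType} {U V : lmodType K} {f : U -> V}.
Hypothesis lf : linear f.

Let L : {linear U -> V} := HB.pack f (GRing.isLinear.Build _ _ _ _ f lf).

Lemma linear_fun0 : f 0 = 0. Proof. exact: (linear0 L). Qed.
Lemma linear_funD x y : f (x + y) = f x + f y. Proof. exact: (linearD L). Qed.
Lemma linear_funB x y : f (x - y) = f x - f y. Proof. exact: (linearB L). Qed.
Lemma linear_funZ a x : f (a *: x) = a *: f x. Proof. exact: (linearZ_LR L). Qed.
Lemma linear_fun_sum (I : Type) (r : seq I) (u : I -> U) :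
  f (\sum_(i <- r) u i) = \sum_(i <- r) f (u i).
Proof. exact: (linear_sum L). Qed.

End LinearFunctions.

Section PositiveForms.
Context {R : realType} {V : lmodType R[i]}.
Variable f : V -> V -> R[i].
Hypothesis f_pos : positive_form f.

Lemma positive_formDl x y z : f (x + y) z = f x z + f y z.
Proof. by have [[fl _] _] := f_pos; have := fl z 1 x y; rewrite scale1r /= mul1r. Qed.

Lemma positive_formDr x y z : f z (x + y) = f z x + f z y.
Proof.
have [[_ fr] _] := f_pos; have := fr z 1 x y.
by rewrite scale1r /= rmorph1 mul1r.
Qed.

Lemma positive_form0l z : f 0 z = 0.
Proof. by apply: (addIr (f 0 z)); rewrite -positive_formDl !add0r. Qed.

Lemma positive_form0r z : f z 0 = 0.
Proof. by apply: (addIr (f z 0)); rewrite -positive_formDr !add0r. Qed.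

Lemma positive_formZl a x z : f (a *: x) z = a * f x z.
Proof.
have [[fl _] _] := f_pos; have := fl z a x 0.
by rewrite addr0 positive_form0l addr0.
Qed.

Lemma positive_formZr a x z : f z (a *: x) = Num.conj a * f z x.
Proof.
have [[_ fr] _] := f_pos; have := fr z a x 0.
by rewrite addr0 positive_form0r addr0.
Qed.

Lemma positive_form_sumr (I : Type) (r : seq I) (u : I -> V) z :
  f z (\sum_(i <- r) u i) = \sum_(i <- r) f z (u i).
Proof.
exact: (big_morph (f z) (fun x y => positive_formDr x y z) (positive_form0r z)).
Qed.

Lemma positive_form_suml (I : Type) (r : seq I) (u : I -> V) z :
  f (\sum_(i <- r) u i) z = \sum_(i <- r) f (u i) z.
Proof.
exact: (big_morph (f^~ z) (fun x y => positive_formDl x y z) (positive_form0l z)).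
Qed.

(** Polarization: [f (x + a *: y) (x + a *: y)] is real, hence so is
    [a * f y x + Num.conj a * f x y]; the values [a = 1] and [a = 'i] determine [f x y]. *)
Lemma positive_form_conj x y : f x y = Num.conj (f y x).
Proof.
have fR z : f z z \is Num.real by apply: ger0_real; have [] := f_pos.
have eC (a : R[i]) : Num.conj (a * f y x + Num.conj a * f x y) =
    a * f y x + Num.conj a * f x y.
  apply/CrealP; have := fR (x + a *: y).
  rewrite !positive_formDl !positive_formDr !positive_formZl !positive_formZr.
  have -> : f x x + Num.conj a * f x y + (a * f y x + a * (Num.conj a * f y y)) =
    a * f y x + Num.conj a * f x y + (f x x + (a * Num.conj a) * f y y) by ring.
  by rewrite rpredDr// rpredD// rpredM// -normCK rpredX// normr_real.
have h1 := eC 1; have hi := eC 'i.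
have {}h1 : f y x + f x y = Num.conj (f y x) + Num.conj (f x y).
  by move: h1; rewrite conjC1 !mul1r rmorphD /= => ->.
have {hi} : 'i * (f y x - f x y) = 'i * (Num.conj (f x y) - Num.conj (f y x)).
  move: hi; rewrite rmorphD !rmorphM /= conjCK conjCi !mulNr => hi.
  by rewrite !mulrBr -hi addrC.
move/(mulfI (neq0Ci _)) => h2.
have : 2 * (f x y - Num.conj (f y x)) = 0.
  have -> : 2 * (f x y - Num.conj (f y x)) =
    (f y x + f x y) - (f y x - f x y) - 2 * Num.conj (f y x) by ring.
  by rewrite h1 h2; ring.
by move/eqP; rewrite mulf_eq0 pnatr_eq0 /= subr_eq0 => /eqP.
Qed.

(** The value of the form at [x + c *: y] is nonnegative for every scalar [c]; for [f y y != 0] take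
    the minimizer [c = - (f x y / f y y)]. *)
Lemma positive_form_CauchySchwarz x y : `|f x y| ^+ 2 <= f x x * f y y.
Proof.
have [_ fge0] := f_pos; have fyx : f y x = Num.conj (f x y) by exact: positive_form_conj.
have quad (c : R[i]) : 0 <= f x x + Num.conj c * f x y + c * f y x + c * Num.conj c * f y y.
  have := fge0 (x + c *: y).
  rewrite !positive_formDl !positive_formDr !positive_formZl !positive_formZr.
  by congr (_ <= _); ring.
have [fy0|fy_neq0] := eqVneq (f y y) 0.
  rewrite fy0 mulr0; have [->|fxy_neq0] := eqVneq (f x y) 0.
    by rewrite normr0 expr0n.
  have N0 : 0 < `|f x y| ^+ 2 by rewrite exprn_gt0 ?normr_gt0.
  (* With [f y y = 0] the form at [x + c *: y] is affine in [c] over the reals; this [c] gives it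
     the value [- (f x x + 2)], which is negative. *)
  have := quad (- ((f x x + 1) / `|f x y| ^+ 2) * f x y).
  rewrite fy0 mulr0 addr0 rmorphM rmorphN /=.
  have -> : Num.conj ((f x x + 1) / `|f x y| ^+ 2) = (f x x + 1) / `|f x y| ^+ 2.
    by apply: geC0_conj; rewrite divr_ge0 ?(ltW N0)// addr_ge0.
  rewrite -!mulrA fyx [_^* * _]mulrC -normCK !mulNr divfK ?gt_eqF//.
  have -> : f x x - (f x x + 1) - (f x x + 1) = - (f x x + 2) by ring.
  by rewrite oppr_ge0 => /le_gtF; rewrite ltr_wpDl.
have fy_gt0 : 0 < f y y by rewrite lt_def fy_neq0 fge0.
have := quad (- (f x y / f y y)).
have -> : Num.conj (- (f x y / f y y)) = - (f y x / f y y).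
  by rewrite rmorphN rmorphM fmorphV /= -fyx (geC0_conj (fge0 y)).
have -> : f x x + - (f y x / f y y) * f x y + - (f x y / f y y) * f y x +
    - (f x y / f y y) * - (f y x / f y y) * f y y =
    f x x - (f x y * f y x) / f y y by field.
by rewrite fyx -normCK subr_ge0 ler_pdivrMr.
Qed.

End PositiveForms.

Section HilbertSpaces.
Context {R : realType} {H : hilbertType R}.
Implicit Types (x y z : H) (S T : H -> H).

Lemma hdot_positive : positive_form (@hdot R H).
Proof.
split=> [|x]; last by rewrite hdot_norm exprn_ge0.
by split=> [z a x y|z a x y]; [exact: linearPl | exact: linearPr].
Qed.

Definition hdotDl := positive_formDl hdot_positive.
Definition hdotDr := positive_formDr hdot_positive.
Definition hdotZl := positive_formZl hdot_positive.
Definition hdotZr := positive_formZr hdot_positive.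
Definition hdotC := positive_form_conj hdot_positive.

Lemma hdotNl x y : hdot (- x) y = - hdot x y.
Proof. by rewrite -scaleN1r hdotZl mulN1r. Qed.

Lemma hdotNr x y : hdot x (- y) = - hdot x y.
Proof. by rewrite -scaleN1r hdotZr rmorphN1 mulN1r. Qed.

Lemma hdotBl x y z : hdot (x - y) z = hdot x z - hdot y z.
Proof. by rewrite hdotDl hdotNl. Qed.

Lemma hdotBr x y z : hdot z (x - y) = hdot z x - hdot z y.
Proof. by rewrite hdotDr hdotNr. Qed.

Lemma hdot_inj x y : (forall z, hdot x z = hdot y z) -> x = y.
Proof.
move=> xy; apply/eqP; rewrite -subr_eq0 -normr_eq0 -sqrf_eq0 -hdot_norm.
by rewrite hdotBl xy subrr.
Qed.

Lemma ler_norm_hdot x y : `|hdot x y| <= `|x| * `|y|.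
Proof.
rewrite -(@ler_pXn2r _ 2)// ?nnegrE ?mulr_ge0// exprMn -!hdot_norm.
exact: positive_form_CauchySchwarz hdot_positive x y.
Qed.

Lemma cvg_hdot (I : Type) (F : set_system I) (FF : Filter F) (f g : I -> H) x y :
  f @ F --> x -> g @ F --> y -> hdot (f i) (g i) @[i --> F] --> hdot x y.
Proof.
move=> fx gy; apply/cvgrPdist_le => e e0.
(* Chosen so that [|x| * d + d * (|y| + 1) = e], where [|y| + 1] eventually bounds the norm of
   [g i]. *)
pose d := e / (`|x| + `|y| + 1).
have s0 : 0 < `|x| + `|y| + 1 by rewrite ltr_wpDl ?addr_ge0.
have d0 : 0 < d by rewrite divr_gt0.
near=> i.
have -> : hdot x y - hdot (f i) (g i) =
    hdot x (y - g i) + hdot (x - f i) (g i).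
  by rewrite hdotBl hdotBr; ring.
have fi : `|x - f i| <= d by near: i; exact: cvgr_dist_le.
have gi : `|y - g i| <= d by near: i; exact: cvgr_dist_le.
have gi1 : `|g i| <= `|y| + 1.
  have -> : g i = y - (y - g i) by rewrite opprB addrC subrK.
  apply: le_trans (ler_normB _ _) _; rewrite lerD2l.
  by near: i; exact: cvgr_dist_le.
apply: le_trans (ler_normD _ _) _.
have -> : e = `|x| * d + d * (`|y| + 1).
  by rewrite [_ * d]mulrC -mulrDr addrA /d divfK ?gt_eqF.
by apply: lerD; apply: le_trans (ler_norm_hdot _ _) _;
  rewrite ?ler_wpM2l// ler_pM.
Unshelve. all: by end_near. Qed.

Lemma positive_op_form T : positive_op T ->
  positive_form (fun x y => hdot (T x) y).
Proof.
case=> -[linT _] T0; split=> //; split=> [z a x y|z a x y].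
  by rewrite linT hdotDl hdotZl.
by rewrite hdotDr hdotZr.
Qed.

Lemma bounded_op_le T : bounded_op T ->
  exists2 K : R[i], 0 < K & forall x, `|T x| <= K * `|x|.
Proof.
case=> linT contT.
pose L : {linear H -> H} := HB.pack T (GRing.isLinear.Build _ _ _ _ T linT).
have : bounded_near L (nbhs (0 : H)) by apply/linear_bounded_continuous.
by move/linear_boundedP/pinfty_ex_gt0.
Qed.

Lemma le_bounded_op T (K : R[i]) : linear T -> 0 <= K ->
  (forall x, `|T x| <= K * `|x|) -> bounded_op T.
Proof.
move=> linT K0 TK; split=> //.
pose L : {linear H -> H} := HB.pack T (GRing.isLinear.Build _ _ _ _ T linT).
suff : continuous L by [].
apply/linear_bounded_continuous/linear_boundedP.
near=> r => x; apply: le_trans (TK x) _; rewrite ler_wpM2r//; near: r.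
by apply: nbhs_pinfty_ge; exact: ger0_real.
Unshelve. all: by end_near. Qed.

End HilbertSpaces.

(** * Superadditivity of the geometric mean of forms *)

Section LocallyBounded.
Context {R : realType}.
Implicit Types f g : R * R -> R.
Local Notation blb := borel_locally_bounded.

Lemma blb_fst : blb (@fst R R).
Proof.
split; first by apply: measurable_funTS; exact: measurable_fst.
by move=> c; exists c => p [p1 p2] p1c _; rewrite ger0_norm.
Qed.

Lemma blb_snd : blb (@snd R R).
Proof.
split; first by apply: measurable_funTS; exact: measurable_snd.
by move=> c; exists c => p [p1 p2] _ p2c; rewrite ger0_norm.
Qed.

Lemma blb_cst a : blb (fun _ : R * R => a).
Proof. by split; [exact: measurable_cst | move=> c; exists `|a|]. Qed.

Lemma blbD f g : blb f -> blb g -> blb (fun p => f p + g p).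
Proof.
move=> [mf bf] [mg bg]; split; first exact: measurable_funD.
move=> c; have [[K fK] [L gL]] := (bf c, bg c); exists (K + L) => p qp p1 p2.
by rewrite (le_trans (ler_normD _ _))// lerD ?fK ?gL.
Qed.

Lemma blbM f g : blb f -> blb g -> blb (fun p => f p * g p).
Proof.
move=> [mf bf] [mg bg]; split; first exact: measurable_funM.
move=> c; have [[K fK] [L gL]] := (bf c, bg c); exists (K * L) => p qp p1 p2.
by rewrite normrM ler_pM ?fK ?gL.
Qed.

Lemma blbZ a f : blb f -> blb (fun p => a * f p).
Proof. by apply: blbM; exact: blb_cst. Qed.

Lemma blb_sqrt f : (forall p, quadrant p -> 0 <= f p) -> blb f ->
  blb (fun p => Num.sqrt (f p)).
Proof.
move=> f0 [mf bf]; split.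
  apply: (@eq_measurable_fun _ _ _ _ _ (fun p => f p `^ 2^-1)).
    by move=> p /set_mem qp; rewrite powR12_sqrt ?f0.
  exact: (measurableT_comp (measurable_powR _) mf).
(* The bound comes from [Num.sqrt t <= t + 1], a consequence of [(Num.sqrt t - 1) ^+ 2 >= 0]. *)
move=> c; have [K fK] := bf c; exists (K + 1) => p qp p1 p2.
have fp0 := f0 _ qp; have := fK _ qp p1 p2; rewrite !ger0_norm ?sqrtr_ge0// => fpK.
rewrite -[f p]sqr_sqrtr// in fpK; have := sqr_ge0 (Num.sqrt (f p) - 1); nra.
Qed.

(** The ratio is at most 1 where [f + g] is nonzero, and it is 0 elsewhere because the inverse of 0
    is 0. Measurability is that of the power with exponent -1, which follows the same convention at
    0. *)
Lemma blb_ratio f g : (forall p, quadrant p -> 0 <= f p) ->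
  (forall p, quadrant p -> 0 <= g p) -> blb f -> blb g ->
  blb (fun p => g p / (f p + g p)).
Proof.
move=> f0 g0 [mf bf] [mg bg]; split.
  apply: (@eq_measurable_fun _ _ _ _ _ (fun p => g p * (f p + g p) `^ (-1))).
    by move=> p /set_mem qp; rewrite powR_inv1// addr_ge0 ?f0 ?g0.
  apply: measurable_funM => //.
  exact: (measurableT_comp (measurable_powR _) (measurable_funD mf mg)).
move=> c; exists 1 => p qp _ _.
have [fp gp] := (f0 _ qp, g0 _ qp).
rewrite ger0_norm ?divr_ge0 ?addr_ge0//.
have [s0|s_neq0] := eqVneq (f p + g p) 0; first by rewrite s0 invr0 mulr0.
by rewrite ler_pdivrMr ?mul1r ?lerDr// lt_def s_neq0 addr_ge0.
Qed.

End LocallyBounded.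

(** * Positivity and parallel sums in the functional calculus *)

Section BorelCalculusTheory.
Context {R : realType} {H : hilbertType R}.
Variables (A B : H -> H) (F : (R * R -> R) -> H -> H).
Hypothesis FP : borel_calculus A B F.
Implicit Types f g : R * R -> R.
Local Notation blb := borel_locally_bounded.

Lemma borel_calculus_eq f g : blb f -> blb g ->
  (forall p, quadrant p -> f p = g p) -> F f = F g.
Proof.
move=> bf bg fg; apply/funext => x.
have : F f x @[_ --> \oo] --> F g x.
  apply: (borel_calculus_cvg FP (u := fun _ => f)) => //.
    by move=> c; have [_ /(_ c)[K fK]] := bf; exists K => _; exact: fK.
  by move=> p qp; rewrite fg//; exact: cvg_cst.
by move/(cvg_unique (@norm_hausdorff _ _))/(_ (cvg_cst _)).
Qed.

(** [F f] is the square of the self-adjoint operator [F (Num.sqrt f)], so the value is a squared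
    norm. *)
Lemma borel_calculus_ge0 f : blb f -> (forall p, quadrant p -> 0 <= f p) ->
  forall x, 0 <= hdot (F f x) x.
Proof.
move=> bf f0 x; have bs := blb_sqrt f0 bf.
have -> : F f = F (fun p => Num.sqrt (f p)) \o F (fun p => Num.sqrt (f p)).
  rewrite -(borel_calculusM FP)//; apply: borel_calculus_eq => //.
    exact: blbM.
  by move=> p qp; rewrite -expr2 sqr_sqrtr ?f0.
by rewrite /= (borel_calculus_selfadjoint FP)// hdot_norm exprn_ge0.
Qed.

(** The factor [g / (f + g)] is bounded, so the product stays in the class of locally bounded
    functions and multiplicativity of [F] applies to it. Where two nonnegative functions both vanish
    the value is 0, as it should be. *)
Definition parallel_sum f g p := f p * (g p / (f p + g p)).

Variables f g : R * R -> R.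
Hypotheses (f0 : forall p, quadrant p -> 0 <= f p)
  (g0 : forall p, quadrant p -> 0 <= g p) (bf : blb f) (bg : blb g).

Let ratio p := g p / (f p + g p).
Let bratio : blb ratio. Proof. exact: blb_ratio. Qed.
Let P := F ratio.

(** Rewritten as [F f (P x) = F g (x - P x)], this is the condition for [P x] to be a critical point
    of the sum of [F f] at [u] and [F g] at [x - u]. Where [f + g = 0] the cancellation holds since
    [g] vanishes too. *)
Let sum_ratio x : F f (P x) + F g (P x) = F g x.
Proof.
have E : F (fun p => (f p + g p) * ratio p) = F g.
  apply: borel_calculus_eq => //; first exact/blbM/bratio/blbD.
  move=> p qp; rewrite /ratio mulrCA.
  have [s0|s_neq0] := eqVneq (f p + g p) 0; last by rewrite divff ?mulr1.
  move/eqP: s0; rewrite paddr_eq0 ?f0 ?g0// => /andP[_ /eqP->].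
  by rewrite mul0r.
rewrite -[RHS](congr1 (fun T => T x) E) (borel_calculusM FP)//=; last exact: blbD.
by rewrite (borel_calculusD FP).
Qed.

Let FB h : blb h -> forall x y, F h (x - y) = F h x - F h y.
Proof. by move=> /(borel_calculus_bounded FP)[lh _]; exact: linear_funB. Qed.

Lemma parallel_sum_attained z : exists u,
  hdot (F (parallel_sum f g) z) z = hdot (F f u) u + hdot (F g (z - u)) (z - u).
Proof.
exists (P z); rewrite /parallel_sum (borel_calculusM FP)//= -/P FB//.
have -> : F f (P z) = F g z - F g (P z) by rewrite -sum_ratio addrK.
by rewrite !hdotBl !hdotBr; ring.
Qed.

(** Completing the square: the right side minus the left side is the quadratic form of [F f + F g]
    at [u - P z]. *)
Lemma parallel_sum_le z u :
  hdot (F (parallel_sum f g) z) z <= hdot (F f u) u + hdot (F g (z - u)) (z - u).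
Proof.
have sa h := borel_calculus_selfadjoint FP h.
pose w := u - P z.
have : 0 <= hdot (F f w) w + hdot (F g w) w.
  by rewrite addr_ge0 ?borel_calculus_ge0.
rewrite -subr_ge0; congr (_ <= _).
rewrite /parallel_sum (borel_calculusM FP)//= -/P.
have -> : F f (P z) = F g z - F g (P z) by rewrite -sum_ratio addrK.
(* The following identities remove [F f] from every term that contains [P z], and the commutation of
   [P] with [F g] identifies the remaining cross terms. *)
have Pg : F g (P z) = P (F g z).
  have := borel_calculusM FP bratio bg.
  under eq_fun do rewrite mulrC.
  by rewrite (borel_calculusM FP)// => /(congr1 (fun T => T z)).
have fP y : hdot (F f (P z)) y = hdot (F g z) y - hdot (F g (P z)) y.
  by rewrite -hdotBl -sum_ratio addrK.
have fu : hdot (F f u) (P z) = hdot (F g u) z - hdot (F g u) (P z).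
  by rewrite !sa// -sum_ratio hdotDr addrK.
have gz : hdot (F g z) (P z) = hdot (F g (P z)) z by rewrite Pg !sa.
rewrite /w !FB// !hdotBl !hdotBr fu !fP gz; ring.
Qed.

End BorelCalculusTheory.

(** * The arithmetic-harmonic mean iteration *)

Section ArithmeticHarmonicMean.
Context {R : realType}.
Local Notation blb := borel_locally_bounded.

(** The second component is the harmonic mean [2 f g / (f + g)], written through the parallel sum
    because that operation preserves superadditivity. *)
Fixpoint ah_mean (n : nat) : (R * R -> R) * (R * R -> R) :=
  if n is m.+1 then
    let: (f, g) := ah_mean m in
    (fun p => 2^-1 * (f p + g p), fun p => 2 * parallel_sum f g p)
  else (fst, snd).

Lemma ah_meanS n : ah_mean n.+1 =
  (fun p => 2^-1 * ((ah_mean n).1 p + (ah_mean n).2 p),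
   fun p => 2 * parallel_sum (ah_mean n).1 (ah_mean n).2 p).
Proof. by rewrite /=; case: (ah_mean n). Qed.

Lemma ah_mean_ge0 n p : quadrant p ->
  0 <= (ah_mean n).1 p /\ 0 <= (ah_mean n).2 p.
Proof.
move=> qp; elim: n => [|n [IHf IHg]]; first by case: qp.
by rewrite ah_meanS /parallel_sum /=; split;
  rewrite !(mulr_ge0, invr_ge0, addr_ge0).
Qed.

(** The factor [a + b] cancels in the product of the arithmetic and the harmonic mean. This
    invariant identifies the limit as the square root. *)
Lemma ah_mean_mul n p : quadrant p ->
  (ah_mean n).1 p * (ah_mean n).2 p = p.1 * p.2.
Proof.
move=> qp; elim: n => [//|n IH]; have [f0 g0] := ah_mean_ge0 n qp.
rewrite ah_meanS /parallel_sum /= -IH.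
move: f0 g0; set a := (ah_mean n).1 p; set b := (ah_mean n).2 p => a0 b0.
have [/eqP|s_neq0] := eqVneq (a + b) 0.
  by rewrite paddr_eq0// => /andP[/eqP-> /eqP->]; rewrite !(mulr0, mul0r).
by field.
Qed.

Lemma ah_mean_le n p c : quadrant p -> p.1 <= c -> p.2 <= c ->
  (ah_mean n).1 p <= c /\ (ah_mean n).2 p <= c.
Proof.
move=> qp p1 p2; elim: n => [//|n [IHf IHg]]; have [f0 g0] := ah_mean_ge0 n qp.
rewrite ah_meanS /parallel_sum /=.
move: f0 g0 IHf IHg; set a := (ah_mean n).1 p; set b := (ah_mean n).2 p.
move=> a0 b0 ac bc; split; first by lra.
have [->|s_neq0] := eqVneq (a + b) 0.
  by rewrite invr0 !mulr0 (le_trans a0).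
have s0 : 0 < a + b by rewrite lt_def s_neq0 addr_ge0.
by rewrite !mulrA ler_pdivrMr//; nra.
Qed.

(** The difference of the two means of [a] and [b] is [(a - b) ^+ 2 / (2 * (a + b))], and
    [|a - b| <= a + b], so each step at least halves the distance. *)
Lemma ah_mean_dist n p : quadrant p ->
  `|(ah_mean n).1 p - (ah_mean n).2 p| <= `|p.1 - p.2| / 2 ^+ n.
Proof.
move=> qp; elim: n => [|n IH]; first by rewrite expr0 divr1.
have [f0 g0] := ah_mean_ge0 n qp.
suff : `|(ah_mean n.+1).1 p - (ah_mean n.+1).2 p| <=
    2^-1 * `|(ah_mean n).1 p - (ah_mean n).2 p|.
  move=> /le_trans; apply; rewrite exprSr invfM mulrA [leRHS]mulrC.
  by rewrite ler_wpM2l.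
rewrite ah_meanS /parallel_sum /=.
move: f0 g0; set a := (ah_mean n).1 p; set b := (ah_mean n).2 p => a0 b0.
have [/eqP|s_neq0] := eqVneq (a + b) 0.
  rewrite paddr_eq0// => /andP[/eqP-> /eqP->].
  by rewrite !(mulr0, mul0r, addr0, subrr, normr0).
have s0 : 0 < a + b by rewrite lt_def s_neq0 addr_ge0.
have -> : 2^-1 * (a + b) - 2 * (a * (b / (a + b))) =
  2^-1 * ((a - b) / (a + b)) * (a - b) by field.
rewrite normrM ler_wpM2r// normrM [X in X * _ <= _]ger0_norm ?invr_ge0//.
rewrite -[leRHS]mulr1 ler_wpM2l ?invr_ge0//.
rewrite normrM normfV (gtr0_norm s0) ler_pdivrMr// mul1r.
by rewrite ler_norml; apply/andP; split; lra.
Qed.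

(** This is [(a - b) ^+ 2 >= 0]. The index starts at [n.+1] because the two coordinates come in no
    particular order. *)
Lemma ah_mean_ordered n p : quadrant p ->
  (ah_mean n.+1).2 p <= (ah_mean n.+1).1 p.
Proof.
move=> qp; have [f0 g0] := ah_mean_ge0 n qp; rewrite ah_meanS /parallel_sum /=.
move: f0 g0; set a := (ah_mean n).1 p; set b := (ah_mean n).2 p => a0 b0.
have [/eqP|s_neq0] := eqVneq (a + b) 0.
  by rewrite paddr_eq0// => /andP[/eqP-> /eqP->]; rewrite !(mulr0, mul0r, addr0).
have s0 : 0 < a + b by rewrite lt_def s_neq0 addr_ge0.
by rewrite !mulrA ler_pdivrMr//; have := sqr_ge0 (a - b); nra.
Qed.

(** The constant product places the square root between the two means from the first step on, and
    their distance tends to 0. *)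
Lemma ah_mean_cvg p : quadrant p ->
  (ah_mean n).2 p @[n --> \oo] --> Num.sqrt (p.1 * p.2).
Proof.
move=> qp; apply/cvgrPdist_le => e e0.
have dn : \forall n \near \oo, `|p.1 - p.2| / 2 ^+ n <= e.
  have : `|2^-1| < 1 :> R by rewrite ger0_norm ?invr_ge0// invf_lt1 ?ltr1n.
  move=> /(cvg_geometric `|p.1 - p.2|)/cvgrPdist_le/(_ _ e0).
  apply: filterS => n /=; rewrite sub0r normrN exprVn.
  exact/le_trans/ler_norm.
near=> n.
have [a0 b0] := ah_mean_ge0 n qp; have ab := ah_mean_mul n qp.
have ba : (ah_mean n).2 p <= (ah_mean n).1 p.
  have n0 : (0 < n)%N by near: n; exists 1%N.
  by rewrite -(prednK n0); exact: ah_mean_ordered.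
have r0 : 0 <= Num.sqrt (p.1 * p.2) by exact: sqrtr_ge0.
have r2 : Num.sqrt (p.1 * p.2) ^+ 2 = (ah_mean n).1 p * (ah_mean n).2 p.
  by rewrite sqr_sqrtr ?ab// mulr_ge0//; case: qp.
have : `|(ah_mean n).1 p - (ah_mean n).2 p| <= e.
  by apply: le_trans (ah_mean_dist n qp) _; near: n.
move: a0 b0 ba r0 r2.
set a := (ah_mean n).1 p; set b := (ah_mean n).2 p; set r := Num.sqrt _.
move=> a0 b0 ba r0 r2; rewrite ger0_norm ?subr_ge0// => abe.
have br : b <= r by rewrite -(@ler_pXn2r _ 2)// r2; nra.
have ra : r <= a by rewrite -(@ler_pXn2r _ 2)// r2; nra.
by rewrite ger0_norm ?subr_ge0//; lra.
Unshelve. all: by end_near. Qed.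

Lemma blb_ah_mean n : blb (ah_mean n).1 /\ blb (ah_mean n).2.
Proof.
elim: n => [|n [IHf IHg]]; first by split; [exact: blb_fst | exact: blb_snd].
rewrite ah_meanS /=; split; apply: blbZ; first exact: blbD.
apply: blbM => //; apply: blb_ratio => // p qp.
  by have [] := ah_mean_ge0 n qp.
by have [] := ah_mean_ge0 n qp.
Qed.

Lemma blb_gmean : blb (fun p : R * R => Num.sqrt (p.1 * p.2)).
Proof.
apply: blb_sqrt; first by move=> p [p1 p2]; rewrite mulr_ge0.
exact: blbM blb_fst blb_snd.
Qed.

End ArithmeticHarmonicMean.

(** * Closure properties of the superadditive functions *)

Section Superadditivity.
Context {R : realType} {V : lmodType R[i]}.
Implicit Types f g : R * R -> R.
Local Notation blb := borel_locally_bounded.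

Let quad (H : hilbertType R) (h : V -> H) (F : (R * R -> R) -> H -> H) f x :=
  hdot (F f (h x)) (h x).

(** The minimizing vector lies in [H] and need not come from [V]; density of the range of [h] and
    continuity of the quadratic forms replace it by some [h v] at the cost of [e]. *)
Lemma parallel_sum_approx (H : hilbertType R) (h : {linear V -> H}) A B F f g :
  dense (range h) -> borel_calculus A B F ->
  (forall p, quadrant p -> 0 <= f p) -> (forall p, quadrant p -> 0 <= g p) ->
  blb f -> blb g -> forall x (e : R[i]), 0 < e ->
  exists v, quad h F f v + quad h F g (x - v) <=
    quad h F (parallel_sum f g) x + e.
Proof.
move=> dh FP f0 g0 bf bg x e e0.
have [u uE] := parallel_sum_attained FP f0 g0 bf bg (h x).
pose phi y := hdot (F f y) y + hdot (F g (h x - y)) (h x - y).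
have [_ cf] := borel_calculus_bounded FP bf.
have [_ cg] := borel_calculus_bounded FP bg.
have phi_cvg : phi y @[y --> u] --> phi u.
  have cB : (h x - y) @[y --> u] --> h x - u.
    by apply: cvgB; [exact: cvg_cst | exact: cvg_id].
  apply: cvgD; apply: cvg_hdot => //; first exact: cf.
  by apply: (cvg_comp _ _ cB); exact: cg.
have : nbhs u [set y | `|phi u - phi y| <= e].
  by move/cvgrPdist_le : phi_cvg => /(_ _ e0).
rewrite nbhsE; move=> [W [oW Wu] sW].
have [y [Wy [v _ vE]]] := dh W (ex_intro _ u Wu) oW.
exists v; have := sW _ Wy; rewrite /= -vE /phi -uE.
have phiR z : phi z \is Num.real.
  by rewrite rpredD// ger0_real// (borel_calculus_ge0 FP).
rewrite real_ler_distl; last by rewrite uE rpredB//; exact: phiR.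
by rewrite lerBlDr /quad (linearB h) => /andP[].
Qed.

Variables (H H1 H2 : hilbertType R).
Variables (h : {linear V -> H}) (h1 : {linear V -> H1}) (h2 : {linear V -> H2}).
Variables (A B : H -> H) (F : (R * R -> R) -> H -> H).
Variables (A1 B1 : H1 -> H1) (F1 : (R * R -> R) -> H1 -> H1).
Variables (A2 B2 : H2 -> H2) (F2 : (R * R -> R) -> H2 -> H2).
Hypotheses (dh : dense (range h)) (FP : borel_calculus A B F)
  (FP1 : borel_calculus A1 B1 F1) (FP2 : borel_calculus A2 B2 F2).

(** The three calculi act on different Hilbert spaces, so they are compared through the quadratic
    forms that they induce on [V]. *)
Let superadditive f :=
  forall x, quad h1 F1 f x + quad h2 F2 f x <= quad h F f x.

Lemma superadditiveD f g : blb f -> blb g ->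
  superadditive f -> superadditive g -> superadditive (fun p => f p + g p).
Proof.
move=> bf bg fs gs x; rewrite /quad (borel_calculusD FP)// (borel_calculusD FP1)//.
rewrite (borel_calculusD FP2)// !hdotDl addrACA.
exact: lerD (fs x) (gs x).
Qed.

Lemma superadditiveZ a f : 0 <= a -> blb f ->
  superadditive f -> superadditive (fun p => a * f p).
Proof.
move=> a0 bf fs x; rewrite /quad (borel_calculusZ FP)// (borel_calculusZ FP1)//.
rewrite (borel_calculusZ FP2)// !hdotZl -mulrDr ler_wpM2l ?ler0c//.
exact: fs.
Qed.

(** A splitting [x = v + (x - v)] that is optimal up to [e] for [F] is an admissible splitting for
    both [F1] and [F2]. *)
Lemma superadditive_parallel_sum f g :
  (forall p, quadrant p -> 0 <= f p) -> (forall p, quadrant p -> 0 <= g p) ->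
  blb f -> blb g ->
  superadditive f -> superadditive g -> superadditive (parallel_sum f g).
Proof.
move=> f0 g0 bf bg fs gs x; apply/ler_addgt0Pr => e e0.
have [v /(le_trans _)] := parallel_sum_approx dh FP f0 g0 bf bg x e0; apply.
have := lerD (fs v) (gs (x - v)); rewrite addrACA; apply: le_trans.
by apply: lerD; rewrite /quad linearB;
  [exact: (parallel_sum_le FP1) | exact: (parallel_sum_le FP2)].
Qed.

Lemma superadditive_cvg (u : nat -> R * R -> R) f :
  (forall n, blb (u n)) -> blb f ->
  (forall p, quadrant p -> 0 <= f p) ->
  (forall n p, quadrant p -> 0 <= u n p) ->
  (forall c : R, exists K : R, forall n p, quadrant p ->
     p.1 <= c -> p.2 <= c -> `|u n p| <= K) ->
  (forall p, quadrant p -> u n p @[n --> \oo] --> f p) ->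
  (forall n, superadditive (u n)) -> superadditive f.
Proof.
move=> bu bf f0 u0 uK uf us x; apply/ler_addgt0Pr => e e0.
have qcvg (K : hilbertType R) (k : {linear V -> K}) C D G :
    borel_calculus C D G -> quad k G (u n) x @[n --> \oo] --> quad k G f x.
  move=> GP; apply: cvg_hdot; last exact: cvg_cst.
  exact: (borel_calculus_cvg GP).
have : (quad h F (u n) x - (quad h1 F1 (u n) x + quad h2 F2 (u n) x))
    @[n --> \oo] --> quad h F f x - (quad h1 F1 f x + quad h2 F2 f x).
  apply: cvgB; first exact: qcvg FP.
  by apply: cvgD; [exact: qcvg FP1 | exact: qcvg FP2].
move=> /cvgrPdist_le/(_ _ e0)[n _ /(_ n (leqnn n))] /=.
(* The order of [R[i]] is partial: the distance bound yields inequalities only once the values are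
   known to be real. *)
have qR (K : hilbertType R) (k : {linear V -> K}) C D G w :
    borel_calculus C D G -> blb w -> (forall p, quadrant p -> 0 <= w p) ->
    quad k G w x \is Num.real.
  by move=> GP bw w0; rewrite ger0_real ?(borel_calculus_ge0 GP).
rewrite real_ler_distl; last first.
  have [? ?] := (qR _ h _ _ _ _ FP bf f0, qR _ h _ _ _ _ FP (bu n) (u0 n)).
  have [? ?] := (qR _ h1 _ _ _ _ FP1 bf f0, qR _ h1 _ _ _ _ FP1 (bu n) (u0 n)).
  have [? ?] := (qR _ h2 _ _ _ _ FP2 bf f0, qR _ h2 _ _ _ _ FP2 (bu n) (u0 n)).
  by rewrite !(rpredB, rpredD).
move=> /andP[+ _]; rewrite lerBlDr => /(le_trans _) De.
by rewrite -subr_ge0 addrAC De// subr_ge0; exact: us.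
Qed.

Lemma superadditive_gmean : superadditive fst -> superadditive snd ->
  superadditive (fun p => Num.sqrt (p.1 * p.2)).
Proof.
move=> s1 s2.
(* Both components go through the induction together since each step mixes them; the limit is then
   taken along the harmonic means. *)
have sn n : superadditive (ah_mean n).1 /\ superadditive (ah_mean n).2.
  elim: n => [//|n [IHf IHg]]; have [bf bg] := @blb_ah_mean R n.
  have f0 p qp := (@ah_mean_ge0 R n p qp).1.
  have g0 p qp := (@ah_mean_ge0 R n p qp).2.
  rewrite ah_meanS /=; split.
    apply: superadditiveZ; [by rewrite invr_ge0 | exact: blbD | exact: superadditiveD].
  apply: superadditiveZ => //; last exact: superadditive_parallel_sum.
  by apply: blbM => //; exact: blb_ratio.
apply: (superadditive_cvg (u := fun n => (ah_mean n).2)).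
- by move=> n; case: (@blb_ah_mean R n).
- exact: blb_gmean.
- by move=> p _; exact: sqrtr_ge0.
- by move=> n p /(ah_mean_ge0 n)[].
- move=> c; exists c => n p qp p1 p2.
  by rewrite ger0_norm; [case: (ah_mean_le n qp p1 p2) | case: (ah_mean_ge0 n qp)].
- exact: ah_mean_cvg.
- by move=> n; case: (sn n).
Qed.

End Superadditivity.

(** As [F fst = A] and [F snd = B], the two inequalities between the given forms say exactly that
    the coordinate functions are superadditive. *)
Lemma form_gmean_superadditive (R : realType) (V : lmodType R[i])
    (s1 t1 g1 s2 t2 g2 s t g : V -> V -> R[i]) :
  form_gmean s1 t1 g1 -> form_gmean s2 t2 g2 -> form_gmean s t g ->
  (forall x, s1 x x + s2 x x <= s x x) -> (forall x, t1 x x + t2 x x <= t x x) ->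
  forall x, g1 x x + g2 x x <= g x x.
Proof.
move=> [H1 [h1 [A1 [B1 [F1 [[_ _ _ _ s1E t1E] FP1 g1E]]]]]].
move=> [H2 [h2 [A2 [B2 [F2 [[_ _ _ _ s2E t2E] FP2 g2E]]]]]].
move=> [H [h [A [B [F [[dh _ _ _ sE tE] FP gE]]]]]] les let_ x.
rewrite g1E g2E gE; apply: (superadditive_gmean dh FP FP1 FP2) => {}x.
  by have := les x; rewrite s1E s2E sE (borel_calculus_fst FP)
    (borel_calculus_fst FP1) (borel_calculus_fst FP2).
by have := let_ x; rewrite t1E t2E tE (borel_calculus_snd FP)
  (borel_calculus_snd FP1) (borel_calculus_snd FP2).
Qed.

(** * Square roots of positive operators *)

Lemma num_cvg_unique (K : numFieldType) (u : nat -> K) (x y : K) :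
  u n @[n --> \oo] --> x -> u n @[n --> \oo] --> y -> x = y.
Proof. exact: (cvg_unique (@norm_hausdorff K K)). Qed.

Lemma hilbert_cvg_unique (R : realType) (H : hilbertType R) (u : nat -> H) (x y : H) :
  u n @[n --> \oo] --> x -> u n @[n --> \oo] --> y -> x = y.
Proof. by move=> ux uy; apply: (@cvg_unique H) ux uy; exact: norm_hausdorff. Qed.

Section SquareRootIteration.
Context {R : realType} {H : hilbertType R}.
Variable U : H -> H.
Hypotheses (U_linear : linear U) (U_le : forall x, `|U x| <= `|x|).

(** A fixed point [Q] satisfies [2 Q = U + Q^2], that is [(1 - Q)^2 = 1 - U]: the operator [1 - Q]
    is then a square root of [1 - U]. *)
Fixpoint sqrt_iter (k : nat) (x : H) : H :=
  if k is n.+1 then 2^-1 *: (U x + sqrt_iter n (sqrt_iter n x)) else 0.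

(* The scalar analogue of the iteration, with U = 1, dominates it in norm. *)
Fixpoint sqrt_bound (k : nat) : R :=
  if k is n.+1 then 2^-1 * (1 + sqrt_bound n ^+ 2) else 0.

Lemma sqrt_boundS k : sqrt_bound k.+1 = 2^-1 * (1 + sqrt_bound k ^+ 2).
Proof. by []. Qed.

Lemma sqrt_bound_ge0 k : 0 <= sqrt_bound k.
Proof.
by case: k => //= k; rewrite mulr_ge0 ?invr_ge0// addr_ge0// sqr_ge0.
Qed.

Lemma sqrt_bound_le1 k : sqrt_bound k <= 1.
Proof. by elim: k => //= k IH; have := sqrt_bound_ge0 k; nra. Qed.

Lemma sqrt_bound_nd : nondecreasing_seq sqrt_bound.
Proof.
apply/nondecreasing_seqP => k /=.
by have := sqr_ge0 (1 - sqrt_bound k); nra.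
Qed.

Lemma sqrt_iter_linear k : linear (sqrt_iter k).
Proof.
elim: k => [|k IH] a x y /=; first by rewrite scaler0 addr0.
rewrite U_linear !IH scalerA [a * _]mulrC -scalerA -scalerDr; congr (_ *: _).
by rewrite scalerDr addrACA.
Qed.

Lemma sqrt_iterB k x y : sqrt_iter k (x - y) = sqrt_iter k x - sqrt_iter k y.
Proof. by rewrite addrC -scaleN1r sqrt_iter_linear scaleN1r addrC. Qed.

Let normC2 : `|2^-1| = (2^-1)%:C%C :> R[i].
Proof. by rewrite normfV normr_nat rmorphV ?unitfE ?pnatr_eq0//= rmorph_nat. Qed.

Lemma sqrt_iter_le k x : `|sqrt_iter k x| <= (sqrt_bound k)%:C%C * `|x|.
Proof.
elim: k x => [|k IH] x /=; first by rewrite normr0 mul0r.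
rewrite normrZ normC2 rmorphM -mulrA ler_wpM2l ?ler0c ?invr_ge0//.
apply: le_trans (ler_normD _ _) _; rewrite rmorphD mulrDl rmorph1 mul1r lerD//.
apply: le_trans (IH _) _; rewrite rmorphXn expr2 -mulrA ler_wpM2l//.
by rewrite ler0c sqrt_bound_ge0.
Qed.

Lemma sqrt_iter_le_norm k x : `|sqrt_iter k x| <= `|x|.
Proof.
apply: le_trans (sqrt_iter_le k x) _; rewrite ler_piMl//.
by rewrite -(rmorph1 (real_complex R)) lecR sqrt_bound_le1.
Qed.

(** With [R_k] for the iterates, [R_{k+1}^2 - R_k^2 = (R_{k+1} - R_k) R_{k+1} + R_k (R_{k+1} -
    R_k)]. The scalar sequence obeys the same identity, which gives the bound by induction. *)
Lemma sqrt_iter_step k x : `|sqrt_iter k.+1 x - sqrt_iter k x| <=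
  (sqrt_bound k.+1 - sqrt_bound k)%:C%C * `|x|.
Proof.
elim: k x => [|k IH] x.
  rewrite /= addr0 !subr0 expr0n addr0 mulr1 normrZ normC2.
  by rewrite ler_wpM2l// ler0c invr_ge0.
have d0 : 0 <= (sqrt_bound k.+1 - sqrt_bound k)%:C%C :> R[i].
  by rewrite ler0c subr_ge0 sqrt_bound_nd.
have -> : sqrt_iter k.+2 x - sqrt_iter k.+1 x = 2^-1 *:
    ((sqrt_iter k.+1 (sqrt_iter k.+1 x) - sqrt_iter k (sqrt_iter k.+1 x)) +
     sqrt_iter k (sqrt_iter k.+1 x - sqrt_iter k x)).
  rewrite sqrt_iterB addrA subrK -scalerBr; congr (_ *: _).
  by rewrite opprD addrACA subrr add0r.
have -> : sqrt_bound k.+2 - sqrt_bound k.+1 = 2^-1 *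
  ((sqrt_bound k.+1 - sqrt_bound k) * sqrt_bound k.+1 +
   sqrt_bound k * (sqrt_bound k.+1 - sqrt_bound k)).
  by rewrite [sqrt_bound k.+2]sqrt_boundS [X in _ - X = _]sqrt_boundS; ring.
have h1 := IH (sqrt_iter k.+1 x); have h2 := IH x.
have h3 := sqrt_iter_le k.+1 x.
have h4 := sqrt_iter_le k (sqrt_iter k.+1 x - sqrt_iter k x).
move: (sqrt_bound k.+1) d0 h1 h2 h3 => b d0 h1 h2 h3.
rewrite normrZ normC2 rmorphM -mulrA ler_wpM2l ?ler0c ?invr_ge0//.
apply: le_trans (ler_normD _ _) _; rewrite rmorphD !rmorphM mulrDl -!mulrA.
apply: lerD; first by apply: le_trans h1 _; exact: ler_wpM2l.
apply: le_trans h4 _; apply: ler_wpM2l => //.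
by rewrite ler0c sqrt_bound_ge0.
Qed.

Lemma sqrt_iter_dist k n x : (k <= n)%N ->
  `|sqrt_iter n x - sqrt_iter k x| <= (sqrt_bound n - sqrt_bound k)%:C%C * `|x|.
Proof.
elim: n => [|n IH]; first by rewrite leqn0 => /eqP->; rewrite !subrr normr0 mul0r.
rewrite leq_eqVlt => /orP[/eqP->|]; first by rewrite !subrr normr0 mul0r.
rewrite ltnS => /IH kn.
rewrite -(subrK (sqrt_iter n x) (sqrt_iter n.+1 x)) -addrA.
rewrite -(subrK (sqrt_bound n) (sqrt_bound n.+1)) -[in leRHS]addrA rmorphD mulrDl.
apply: le_trans (ler_normD _ _) _; exact: lerD (sqrt_iter_step n x) kn.
Qed.

Lemma sqrt_iter_is_cvg x : cvg (sqrt_iter k x @[k --> \oo]).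
Proof.
apply: cauchy_cvg; apply: cauchy_exP => e e0.
pose d := e / (`|x| + 1).
have x0 : 0 < `|x| + 1 by rewrite ltr_wpDl.
have d0 : 0 < d by rewrite divr_gt0.
(* The scalar bounds converge in [R] while [e] and [d] are positive elements of [R[i]], so [d] is
   replaced by its real part. *)
have dE : d = (complex.Re d)%:C%C by rewrite RRe_real// gtr0_real.
have rd0 : 0 < complex.Re d by rewrite -ltcR -dE.
have cb : cvgn sqrt_bound.
  apply: nondecreasing_is_cvgn; first exact: sqrt_bound_nd.
  by exists 1 => _ [k _ <-]; exact: sqrt_bound_le1.
have [N _ cN] := (cvgrPdist_lt _ _).1 cb _ rd0.
exists (sqrt_iter N x); exists N => // n /= Nn.
rewrite -ball_normE /= distrC.
apply: le_lt_trans (sqrt_iter_dist x Nn) _.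
apply: (@le_lt_trans _ _ (d * `|x|)).
  rewrite ler_wpM2r// dE lecR.
  have := cN N (leqnn N); have := nondecreasing_cvgn_le sqrt_bound_nd cb n.
  by rewrite /= => ? /ltr_normlW; lra.
by rewrite /d -mulrA gtr_pMr// mulrC ltr_pdivrMr// mul1r ltrDl.
Qed.

Definition sqrt_lim x := lim (sqrt_iter k x @[k --> \oo]).

Lemma sqrt_iter_cvg x : sqrt_iter k x @[k --> \oo] --> sqrt_lim x.
Proof. exact: sqrt_iter_is_cvg. Qed.

Lemma sqrt_lim_linear : linear sqrt_lim.
Proof.
move=> a x y; apply: (hilbert_cvg_unique (@sqrt_iter_cvg _)).
under eq_fun do rewrite sqrt_iter_linear.
by apply: cvgD; [apply: cvgZr|]; exact: sqrt_iter_cvg.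
Qed.

(** Passing to the limit in [R_k (R_k x) = R_k (Q x) + R_k (R_k x - Q x)]: the last term tends to 0
    because every [R_k] is a contraction. *)
Lemma sqrt_lim_sqr x : sqrt_lim x = 2^-1 *: (U x + sqrt_lim (sqrt_lim x)).
Proof.
apply: (hilbert_cvg_unique (@sqrt_iter_cvg _)).
rewrite -cvg_shiftS /=; apply: cvgZr; apply: cvgD; first exact: cvg_cst.
have : sqrt_iter k (sqrt_lim x) + sqrt_iter k (sqrt_iter k x - sqrt_lim x)
    @[k --> \oo] --> sqrt_lim (sqrt_lim x) + 0.
  apply: cvgD; first exact: sqrt_iter_cvg.
  apply/cvgrPdist_le => e e0.
  have [N _ uN] := (cvgrPdist_le _ _).1 (@sqrt_iter_cvg x) _ e0.
  exists N => // k Nk /=; rewrite sub0r normrN.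
  by apply: le_trans (sqrt_iter_le_norm _ _) _; rewrite distrC; exact: uN.
by rewrite addr0; under eq_fun do rewrite sqrt_iterB addrC subrK.
Qed.

Lemma sqrt_lim_le x : `|sqrt_lim x| <= `|x|.
Proof.
apply/ler_addgt0Pr => e e0.
have [k _ /(_ k (leqnn k))] := (cvgrPdist_le _ _).1 (@sqrt_iter_cvg x) _ e0.
move=> /= le_e; rewrite -[sqrt_lim x](subrK (sqrt_iter k x)) addrC.
by apply: le_trans (ler_normD _ _) _; rewrite lerD ?sqrt_iter_le_norm.
Qed.

Lemma sqrt_lim_selfadjoint :
  (forall x y, hdot (U x) y = hdot x (U y)) ->
  forall x y, hdot (sqrt_lim x) y = hdot x (sqrt_lim y).
Proof.
move=> saU x y.
have sa k u v : hdot (sqrt_iter k u) v = hdot u (sqrt_iter k v).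
  elim: k u v => [|k IH] u v /=.
    by rewrite (positive_form0l hdot_positive) (positive_form0r hdot_positive).
  rewrite hdotZl hdotZr hdotDl hdotDr saU !IH.
  by rewrite geC0_conj ?invr_ge0.
have h1 : hdot (sqrt_iter k x) y @[k --> \oo] --> hdot (sqrt_lim x) y.
  by apply: cvg_hdot; [exact: sqrt_iter_cvg | exact: cvg_cst].
have h2 : hdot (sqrt_iter k x) y @[k --> \oo] --> hdot x (sqrt_lim y).
  under eq_fun do rewrite sa.
  by apply: cvg_hdot; [exact: cvg_cst | exact: sqrt_iter_cvg].
exact: (@num_cvg_unique R[i] _ _ _ h1 h2).
Qed.

(** The iterates are polynomials in [U], so [C] commutes with them, and its continuity carries this
    to the limit. *)
Lemma sqrt_lim_commute (C : H -> H) : bounded_op C ->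
  (forall x, C (U x) = U (C x)) -> forall x, C (sqrt_lim x) = sqrt_lim (C x).
Proof.
move=> [linC contC] CU x.
have Ci k u : C (sqrt_iter k u) = sqrt_iter k (C u).
  elim: k u => [|k IH] u /=.
    exact: linear_fun0.
  by rewrite (linear_funZ linC) (linear_funD linC) CU !IH.
have h : C (sqrt_iter k x) @[k --> \oo] --> C (sqrt_lim x).
  by apply: (cvg_comp _ _ (@sqrt_iter_cvg x)); exact: contC.
apply: (hilbert_cvg_unique h).
by under eq_fun do rewrite Ci; exact: sqrt_iter_cvg.
Qed.

End SquareRootIteration.

(** The last clause is what later places the entries of a square root in a bicommutant. *)
Theorem positive_op_sqrt (R : realType) (H : hilbertType R) (T : H -> H) :
  positive_op T -> exists S : H -> H,
    [/\ bounded_op S, forall x y, hdot (S x) y = hdot x (S y),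
        forall x, S (S x) = T x &
        forall C : H -> H, bounded_op C -> (forall x, C (T x) = T (C x)) ->
          forall x, C (S x) = S (C x)].
Proof.
move=> posT; have formT := positive_op_form posT.
have [bT T0] := posT; have [linT _] := bT.
have saT x y : hdot (T x) y = hdot x (T y).
  by rewrite (positive_form_conj formT) -hdotC.
have [K K0 TK] := bounded_op_le bT.
have KC : Num.conj K^-1 = K^-1 by rewrite geC0_conj// invr_ge0 ltW.
(* This is [T^2 <= K T], obtained from the Cauchy-Schwarz inequality for the form of [T] at [x] and
   [T x]. *)
have TT x : `|T x| ^+ 2 <= K * hdot (T x) x.
  have [->|Tx0] := eqVneq (T x) 0.
    by rewrite normr0 expr0n (positive_form0l hdot_positive) mulr0.
  have := positive_form_CauchySchwarz formT x (T x).
  have N0 : 0 < `|T x| ^+ 2 by rewrite exprn_gt0 ?normr_gt0.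
  rewrite hdot_norm normrX normr_id expr2 => h.
  rewrite -(ler_pM2r N0); apply: le_trans h _.
  rewrite [K * _]mulrC -mulrA ler_wpM2l// -(ger0_norm (T0 _)).
  apply: le_trans (ler_norm_hdot _ _) _.
  by rewrite expr2 mulrA ler_wpM2r.
(* By the preceding bound [1 - T / K] is a contraction. The iteration yields [Q] with
   [(1 - Q)^2 = T / K], and the square root of [T] is [1 - Q] scaled by [sqrtC K]. *)
pose U x := x - K^-1 *: T x.
have linU : linear U.
  move=> a x y; rewrite /U linT scalerBr scalerDr !scalerA [K^-1 * a]mulrC.
  by rewrite opprD addrACA.
have U_le x : `|U x| <= `|x|.
  have -> : `|U x| = `|x - K^-1 *: T x| by [].
  rewrite -(@ler_pXn2r _ 2)// ?nnegrE// -!hdot_norm.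
  have -> : hdot (x - K^-1 *: T x) (x - K^-1 *: T x) = hdot x x -
    (K^-1 * hdot (T x) x + K^-1 * (hdot (T x) x - K^-1 * `|T x| ^+ 2)).
    by rewrite !hdotBl !hdotBr !hdotZl !hdotZr KC -(saT x x) (hdot_norm (T x)); ring.
  rewrite gerBl addr_ge0// mulr_ge0 ?invr_ge0 ?(ltW K0) ?T0//.
  by rewrite subr_ge0 ler_pdivrMl.
have saU x y : hdot (U x) y = hdot x (U y).
  by rewrite /U hdotBl hdotBr hdotZl hdotZr saT KC.
pose Q x := sqrt_lim U x.
have linQ : linear Q by exact: sqrt_lim_linear.
have QQ x : Q (Q x) = Q x + Q x - U x.
  have := sqrt_lim_sqr linU U_le x; rewrite -/(Q _) => QE.
  have : 2 *: Q x = U x + Q (Q x).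
    by rewrite [in LHS]QE scalerA divff ?pnatr_eq0// scale1r.
  by rewrite scaler_nat mulr2n => ->; rewrite addrC addKr.
pose r := sqrtC K.
have r0 : 0 <= r by rewrite sqrtC_ge0 ltW.
have rC : Num.conj r = r by exact: geC0_conj.
exists (fun x => r *: (x - Q x)); split.
- apply: (@le_bounded_op _ _ _ (r * 2)); last 2 first.
  + by rewrite mulr_ge0.
  + move=> x; rewrite normrZ ger0_norm// -mulrA ler_wpM2l//.
    apply: le_trans (ler_normB _ _) _; rewrite mulr_natl mulr2n lerD2l.
    exact: sqrt_lim_le.
  move=> a x y; rewrite linQ !scalerBr !scalerDr !scalerA [r * a]mulrC.
  by rewrite opprD addrACA.
- move=> x y; rewrite hdotZl hdotZr rC hdotBl hdotBr; congr (_ * (_ - _)).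
  exact: sqrt_lim_selfadjoint.
- move=> x; rewrite (linear_funZ linQ) (linear_funB linQ) QQ -scalerBr scalerA.
  rewrite -expr2 sqrtCK.
  have -> : x - Q x - (Q x - (Q x + Q x - U x)) = K^-1 *: T x.
    have -> : Q x - (Q x + Q x - U x) = U x - Q x.
      by rewrite opprB addrCA opprD 2!addrA addrK.
    by rewrite opprB addrA subrK /U opprB addrC subrK.
  by rewrite scalerA divff ?gt_eqF// scale1r.
- move=> C bC CT x; have [linC _] := bC.
  rewrite (linear_funZ linC) (linear_funB linC); congr (_ *: (_ - _)).
  apply: sqrt_lim_commute => // y.
  by rewrite /U (linear_funB linC) (linear_funZ linC) CT.
Qed.

(** * Operator matrices *)

(** Only the module structure is taken over from finite functions; the norm given below is the
    Euclidean one, as the inner product requires. *)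
Definition hilbert_sum (R : realType) (H : hilbertType R) (n : nat) :=
  {ffun 'I_n -> H}.

Section HilbertSum.
Context {R : realType} {H : hilbertType R} {n : nat}.
Local Notation Hn := (hilbert_sum H n).

HB.instance Definition _ := GRing.Lmodule.on Hn.

Definition hilbert_sum_dot (x y : Hn) : R[i] := \sum_i hdot (x i) (y i).

Lemma hilbert_sum_dot_positive : positive_form hilbert_sum_dot.
Proof.
split=> [|x]; last first.
  by apply: sumr_ge0 => i _; rewrite hdot_norm exprn_ge0.
split=> [z a x y|z a x y]; rewrite /hilbert_sum_dot /= mulr_sumr -big_split;
  apply: eq_bigr => i _; rewrite !ffunE.
  by rewrite hdotDl hdotZl.
by rewrite hdotDr hdotZr.
Qed.

Local Notation dot := hilbert_sum_dot.
Local Notation dotP := hilbert_sum_dot_positive.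

Definition hilbert_sum_norm (x : Hn) : R[i] := sqrtC (dot x x).

Lemma hilbert_sum_norm_sqr x : hilbert_sum_norm x ^+ 2 = dot x x.
Proof. exact: sqrtCK. Qed.

Lemma hilbert_sum_norm_ge0 x : 0 <= hilbert_sum_norm x.
Proof. by rewrite sqrtC_ge0; have [_] := dotP. Qed.

Lemma hilbert_sum_normD (x y : Hn) :
  hilbert_sum_norm (x + y) <= hilbert_sum_norm x + hilbert_sum_norm y.
Proof.
have [x0 y0] := (hilbert_sum_norm_ge0 x, hilbert_sum_norm_ge0 y).
rewrite -(@ler_pXn2r _ 2)// ?nnegrE ?addr_ge0 ?hilbert_sum_norm_ge0//.
rewrite sqrrD !hilbert_sum_norm_sqr (positive_formDl dotP) !(positive_formDr dotP).
have xy : `|dot x y| <= hilbert_sum_norm x * hilbert_sum_norm y.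
  rewrite -(@ler_pXn2r _ 2)// ?nnegrE ?mulr_ge0// exprMn !hilbert_sum_norm_sqr.
  exact: positive_form_CauchySchwarz dotP x y.
have -> : dot x x + dot x y + (dot y x + dot y y) =
  dot x x + (dot x y + dot y x) + dot y y by ring.
rewrite lerD2r lerD2l (positive_form_conj dotP y x).
apply: le_trans (_ : `|dot x y| *+ 2 <= _); last by rewrite lerMn2r xy orbT.
have := (leif_Re_Creal (dot x y)).1.
by rewrite ReE ler_pdivrMr// mulr_natr.
Qed.

Lemma hilbert_sum_normZ (a : R[i]) (x : Hn) :
  hilbert_sum_norm (a *: x) = `|a| * hilbert_sum_norm x.
Proof.
rewrite /hilbert_sum_norm (positive_formZl dotP) (positive_formZr dotP) mulrA -normCK.
by rewrite rootCMl ?exprn_ge0// sqrCK.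
Qed.

Lemma hilbert_sum_norm_coord (x : Hn) i : `|x i| <= hilbert_sum_norm x.
Proof.
rewrite -(@ler_pXn2r _ 2)// ?nnegrE ?hilbert_sum_norm_ge0// hilbert_sum_norm_sqr.
rewrite -hdot_norm /hilbert_sum_dot (bigD1 i)//= lerDl.
by apply: sumr_ge0 => j _; rewrite hdot_norm exprn_ge0.
Qed.

Lemma hilbert_sum_norm0 (x : Hn) : hilbert_sum_norm x = 0 -> x = 0.
Proof.
move=> x0; apply/ffunP => i; rewrite ffunE; apply/eqP; rewrite -normr_le0 -x0.
exact: hilbert_sum_norm_coord.
Qed.

HB.instance Definition _ := Lmodule_isNormed.Build R[i] Hn
  hilbert_sum_normD hilbert_sum_normZ hilbert_sum_norm0.

Lemma hilbert_sum_normE (x : Hn) : `|x| = hilbert_sum_norm x.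
Proof. by []. Qed.

Definition hilbert_sum_in (i : 'I_n) (v : H) : Hn :=
  [ffun j => if j == i then v else 0].

Lemma hilbert_sum_in_linear i : linear (hilbert_sum_in i).
Proof.
by move=> a x y; apply/ffunP => j; rewrite !ffunE; case: eqP; rewrite ?scaler0 ?addr0.
Qed.

Lemma hilbert_sum_in_dotl i v (x : Hn) : dot (hilbert_sum_in i v) x = hdot v (x i).
Proof.
rewrite /hilbert_sum_dot (bigD1 i)//= ffunE eqxx big1 ?addr0// => j /negbTE ji.
by rewrite ffunE ji (positive_form0l hdot_positive).
Qed.

Lemma norm_hilbert_sum_in i v : `|hilbert_sum_in i v| = `|v|.
Proof.
rewrite hilbert_sum_normE /hilbert_sum_norm hilbert_sum_in_dotl ffunE eqxx.
by rewrite hdot_norm sqrCK.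
Qed.

Lemma hilbert_sum_eq_sum (x : Hn) : x = \sum_i hilbert_sum_in i (x i).
Proof.
apply/ffunP => j; rewrite sum_ffunE (bigD1 j)//= ffunE eqxx big1 ?addr0// => i.
by rewrite ffunE eq_sym => /negbTE->.
Qed.

Lemma ler_hilbert_sum_norm (x : Hn) : `|x| <= \sum_i `|x i|.
Proof.
rewrite [in leLHS](hilbert_sum_eq_sum x); apply: le_trans (ler_norm_sum _ _ _) _.
by apply: ler_sum => i _; rewrite norm_hilbert_sum_in.
Qed.

Lemma hilbert_sum_complete (F : set_system Hn) : ProperFilter F -> cauchy F -> cvg F.
Proof.
move=> FF cF.
have cFi i : cvg ((fun x : Hn => x i) @ F).
  apply: cauchy_cvg; apply/cauchy_ballP => e e0.
  have [[P Q] [/= FP FQ] PQ] := (cauchy_ballP F).2 cF e e0.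
  exists ([set x i | x in P], [set x i | x in Q]).
    by split; [apply: filterS FP | apply: filterS FQ] => x Px; exists x.
  move=> [_ _] [[x Px <-] [y Qy <-]]; have := PQ (x, y) (conj Px Qy).
  rewrite -!ball_normE /=; apply: le_lt_trans.
  by have := hilbert_sum_norm_coord (x - y) i; rewrite !ffunE.
pose l : Hn := [ffun i => lim ((fun x : Hn => x i) @ F)].
apply/cvg_ex; exists l; apply/(@cvgrPdist_lt _ Hn _ F _ id) => e e0.
(* Dividing by [n.+1] covers [n = 0] and keeps the sum of the [n] coordinate bounds strictly below
   [e]. *)
have d0 : 0 < e / n.+1%:R by rewrite divr_gt0.
have : F [set x : Hn | forall i, `|l i - x i| < e / n.+1%:R].
  apply: filter_forall => i; rewrite ffunE.
  by have /cvgrPdist_lt/(_ _ d0) := cFi i.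
apply: filterS => x lx /=; apply: le_lt_trans (ler_hilbert_sum_norm _) _.
apply: (@le_lt_trans _ _ (\sum_(i < n) e / n.+1%:R)).
  by apply: ler_sum => i _; have := lx i; rewrite !ffunE => /ltW.
rewrite sumr_const card_ord -[e / _ *+ n]mulr_natr -mulrA gtr_pMr//.
by rewrite mulrC ltr_pdivrMr// mul1r ltr_nat.
Qed.

HB.instance Definition _ := Uniform_isComplete.Build Hn hilbert_sum_complete.

HB.instance Definition _ := @bilinear_isBilinear.Build R[i] Hn Hn R[i]
  ( *%R ) (Num.conj \; *%R) hilbert_sum_dot hilbert_sum_dot_positive.1.

Lemma hilbert_sum_dot_hermitian (x y : Hn) :
  dot x y = (-1) ^+ false * Num.conj (dot y x).
Proof. by rewrite mul1r; exact: positive_form_conj dotP x y. Qed.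

HB.instance Definition _ := @isHermitianSesquilinear.Build R[i] Hn false
  (@Num.conj R[i]) hilbert_sum_dot hilbert_sum_dot_hermitian.

Lemma hilbert_sum_dot_norm (x : Hn) : dot x x = `|x| ^+ 2.
Proof. by rewrite hilbert_sum_normE hilbert_sum_norm_sqr. Qed.

Lemma hilbert_sum_dot_gt0 (x : Hn) : x != 0 -> 0 < dot x x.
Proof. by move=> x0; rewrite hilbert_sum_dot_norm exprn_gt0// normr_gt0. Qed.

HB.instance Definition _ := @isDotProduct.Build R[i] Hn hilbert_sum_dot
  hilbert_sum_dot_gt0.

HB.instance Definition _ := @isHilbert.Build R Hn hilbert_sum_dot hilbert_sum_dot_norm.

End HilbertSum.

Lemma hilbert_sum_hdotE (R : realType) (H : hilbertType R) n
    (x y : hilbert_sum H n) :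
  hdot x y = \sum_i hdot (x i) (y i).
Proof. by []. Qed.

Lemma hdot_hilbert_sum_in (R : realType) (H : hilbertType R) n
    (x : hilbert_sum H n) i v :
  hdot x (hilbert_sum_in i v) = hdot (x i) v.
Proof.
by rewrite hdotC [RHS]hdotC; congr Num.conj; exact: hilbert_sum_in_dotl.
Qed.

(** * Operators on a finite direct sum and their entries *)

Section OperatorMatrix.
Context {R : realType} {H : hilbertType R} {n : nat}.
Variable A : 'I_n -> 'I_n -> H -> H.
Hypothesis bA : forall i j, bounded_op (A i j).

Definition op_mx (x : hilbert_sum H n) : hilbert_sum H n :=
  [ffun i => \sum_j A i j (x j)].

Lemma op_mx_bounded : bounded_op op_mx.
Proof.
have /choice[K KP] : forall ij : 'I_n * 'I_n, exists K : R[i],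
    0 <= K /\ forall x, `|A ij.1 ij.2 x| <= K * `|x|.
  by move=> [i j]; have [K /ltW K0 KA] := bounded_op_le (bA i j); exists K.
apply: (@le_bounded_op _ _ _ (\sum_i \sum_j K (i, j))).
- move=> a x y; apply/ffunP => i; rewrite !ffunE scaler_sumr -big_split.
  by apply: eq_bigr => j _; rewrite !ffunE; have [-> _] := bA i j.
- by apply: sumr_ge0 => i _; apply: sumr_ge0 => j _; case: (KP (i, j)).
move=> x; apply: le_trans (ler_hilbert_sum_norm _) _; rewrite mulr_suml.
apply: ler_sum => i _; rewrite ffunE; apply: le_trans (ler_norm_sum _ _ _) _.
rewrite mulr_suml; apply: ler_sum => j _; have [K0 KA] := KP (i, j).
apply: le_trans (KA _) _; rewrite ler_wpM2l//.
exact: hilbert_sum_norm_coord.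
Qed.

Lemma op_mx_in j v i : op_mx (hilbert_sum_in j v) i = A i j v.
Proof.
rewrite ffunE (bigD1 j)//= ffunE eqxx big1 ?addr0// => k /negbTE kj.
by rewrite ffunE kj; have [lA _] := bA i k; exact: linear_fun0.
Qed.

End OperatorMatrix.

Section OperatorEntries.
Context {R : realType} {H : hilbertType R} {n : nat}.
Variable S : hilbert_sum H n -> hilbert_sum H n.
Hypothesis bS : bounded_op S.

Definition op_entry i j v := S (hilbert_sum_in j v) i.

Lemma op_entry_bounded i j : bounded_op (op_entry i j).
Proof.
have [K K0 SK] := bounded_op_le bS; have [lS _] := bS.
apply: (@le_bounded_op _ _ _ K) => [a x y||x]; last 2 first.
- exact: ltW.
- rewrite /op_entry; apply: le_trans (hilbert_sum_norm_coord _ _) _.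
  by apply: le_trans (SK _) _; rewrite norm_hilbert_sum_in.
by rewrite /op_entry hilbert_sum_in_linear lS !ffunE.
Qed.

End OperatorEntries.

Lemma von_neumann_rep_positive_mx (R : realType) (N : starAlgebraType R)
    (H : hilbertType R) (rho : N -> H -> H) (n : nat) (D : 'M[N]_n) :
  von_neumann_rep rho ->
  (forall xi : 'I_n -> H,
    0 <= \sum_i \sum_j hdot (rho (D i j) (xi j)) (xi i)) ->
  positive_mx D.
Proof.
move=> vn D0.
pose T := op_mx (fun i j => rho (D i j)).
have bD i j : bounded_op (rho (D i j)) by exact: vnrep_bounded vn _.
have posT : positive_op T.
  split=> [|x]; first exact: op_mx_bounded.
  rewrite hilbert_sum_hdotE; have := D0 x; congr (_ <= _).
  apply: eq_bigr => i _; rewrite ffunE.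
  by rewrite (positive_form_suml hdot_positive).
have [S [bS saS SS comS]] := positive_op_sqrt posT.
have entry_vn i j : range rho (op_entry S i j).
  rewrite -(vnrep_bicommutant vn); split=> [|c [bc cN]].
    exact: op_entry_bounded.
  (* The diagonal action of [c] commutes with [T] because [c] commutes with every [rho (D i j)];
     hence it commutes with [S], and [c] with each entry of [S]. *)
  pose C (x : hilbert_sum H n) : hilbert_sum H n := [ffun k => c (x k)].
  have [lc _] := bc.
  have bC : bounded_op C.
    have [K K0 cK] := bounded_op_le bc.
    apply: (@le_bounded_op _ _ _ (\sum_(k < n) K)).
    - by move=> a x z; apply/ffunP => k; rewrite !ffunE lc.
    - by apply: sumr_ge0 => k _; exact: ltW.
    move=> x; apply: le_trans (ler_hilbert_sum_norm _) _; rewrite mulr_suml.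
    apply: ler_sum => k _; rewrite ffunE; apply: le_trans (cK _) _.
    by rewrite ler_pM2l//; exact: hilbert_sum_norm_coord.
  have Cin v : C (hilbert_sum_in j v) = hilbert_sum_in j (c v).
    by apply/ffunP => k; rewrite !ffunE; case: eqP => // _; exact: linear_fun0.
  have cD a b v : c (rho (D a b) v) = rho (D a b) (c v).
    by have /(congr1 (fun f => f v)) := cN (rho (D a b)) (ex_intro2 _ _ _ I erefl).
  apply/funext => v; rewrite /= /op_entry -Cin -comS//; first by rewrite ffunE.
  move=> x; apply/ffunP => k; rewrite !ffunE (linear_fun_sum lc).
  by apply: eq_bigr => l _; rewrite !ffunE cD.
have /choice[y yS] : forall ij : 'I_n * 'I_n, exists a, rho a = op_entry S ij.1 ij.2.
  by move=> [i j]; have [a _ aE] := entry_vn i j; exists a.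
exists (\matrix_(i, j) y (i, j)); apply/matrixP => i j; rewrite mxE.
apply: (vnrep_inj vn); apply/funext => v; apply: hdot_inj => w.
have lrho z : linear (fun a => rho a z).
  by move=> a b1 b2; exact: vnrep_linear vn _ _ _ _.
rewrite (linear_fun_sum (lrho v)) (positive_form_suml hdot_positive).
(* Comparing entries in [T = S S] with [S] self-adjoint: the inner product becomes that of columns
   [j] and [i] of [S], which is the sum over [k] defining a positive matrix. *)
have -> : hdot (rho (D i j) v) w = hdot (T (hilbert_sum_in j v)) (hilbert_sum_in i w).
  by rewrite hdot_hilbert_sum_in /T op_mx_in.
rewrite -SS saS hilbert_sum_hdotE; apply: eq_bigr => k _.
by rewrite (vnrepM vn) /= (vnrep_star vn) !mxE !yS.
Qed.

(** * Completely positive maps *)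

Lemma positive_formD (R : realType) (V : lmodType R[i]) (s t : V -> V -> R[i]) :
  positive_form s -> positive_form t -> positive_form (fun x y => s x y + t x y).
Proof.
move=> [[sl sr] s0] [[tl tr] t0]; split=> [|x]; last by rewrite addr_ge0.
split=> [z a x y|z a x y] /=; first by rewrite sl tl mulrDr addrACA.
by rewrite sr tr /= mulrDr addrACA.
Qed.

Lemma form_gmean_positive (R : realType) (V : lmodType R[i])
    (s t g : V -> V -> R[i]) : form_gmean s t g -> positive_form g.
Proof.
move=> [H [h [A [B [F [_ FP gE]]]]]].
have [lF _] := borel_calculus_bounded FP blb_gmean.
split=> [|x]; last first.
  rewrite gE; apply: (borel_calculus_ge0 FP blb_gmean) => p _.
  exact: sqrtr_ge0.
split=> [z a x y|z a x y] /=; rewrite !gE linearP.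
  by rewrite lF hdotDl hdotZl.
by rewrite hdotDr hdotZr.
Qed.

(** The universal property only concerns linear maps, so it is applied in the first variable;
    Hermitian symmetry transfers the result to the second. *)
Lemma alg_tensor_form_eq (R : realType) (U V : lmodType R[i])
    (T : alg_tensor U V) (s t : T -> T -> R[i]) :
  positive_form s -> positive_form t ->
  (forall x y u v, s (tensor T x u) (tensor T y v) =
                   t (tensor T x u) (tensor T y v)) ->
  forall z w, s z w = t z w.
Proof.
move=> ps pt st.
have ext w : (forall x u, s (tensor T x u) w = t (tensor T x u) w) ->
    forall z, s z w = t z w.
  move=> stw.
  have [[[sl _] _] [[tl _] _]] := (ps, pt).
  pose fs : {linear T -> R[i]^o} := HB.pack (fun z => s z w : R[i]^o)
    (GRing.isLinear.Build _ _ _ _ (fun z => s z w : R[i]^o) (sl w)).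
  pose ft : {linear T -> R[i]^o} := HB.pack (fun z => t z w : R[i]^o)
    (GRing.isLinear.Build _ _ _ _ (fun z => t z w : R[i]^o) (tl w)).
  exact: (@tensor_ext _ _ _ T _ fs ft stw).
move=> z w; apply: (ext w) => x u.
rewrite (positive_form_conj ps) (positive_form_conj pt); congr Num.conj.
by apply: ext => y v; exact: st.
Qed.

Section CompletelyPositiveForms.
Context {R : realType} {M N : vonNeumannType R} {L2 : standard_form N}.
Variable T : alg_tensor M L2.

Lemma L2_rep_linear (xi : L2) : linear (fun a => L2_rep a xi).
Proof. by move=> c a b; exact: vnrep_linear (L2_von_neumann_rep L2) _ _ _ _. Qed.

Lemma is_cp_formD (Phi Psi : {linear M -> N}) (s t : T -> T -> R[i]) :
  is_cp_form Phi s -> is_cp_form Psi t ->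
  is_cp_form (Phi \+ Psi) (fun x y => s x y + t x y).
Proof.
move=> [ps sE] [pt tE]; split=> [|x y xi eta]; first exact: positive_formD.
by rewrite sE tE /= (linear_funD (L2_rep_linear xi)) hdotDl.
Qed.

(** This allows the form attached to a sum of maps to be replaced by the sum of their forms. *)
Lemma is_cp_form_unique (Phi : {linear M -> N}) (s t : T -> T -> R[i]) :
  is_cp_form Phi s -> is_cp_form Phi t -> forall z w, s z w = t z w.
Proof.
move=> [ps sE] [pt tE]; apply: alg_tensor_form_eq => // x y xi eta.
by rewrite sE tE.
Qed.

(** Each row [k] of [Y] contributes one vector of the tensor product, and expanding [g] there gives
    the double sum. Matrix positivity of [Theta] is thereby expressed through the quadratic form of
    [g]. *)
Lemma cp_form_sum (Theta : {linear M -> N}) (g : T -> T -> R[i]) n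
    (Y : 'M[M]_n) (xi : 'I_n -> L2) :
  is_cp_form Theta g ->
  \sum_i \sum_j hdot (L2_rep (Theta (\sum_k star (Y k i) ** Y k j)) (xi j)) (xi i) =
  \sum_k g (\sum_j tensor T (Y k j) (xi j)) (\sum_j tensor T (Y k j) (xi j)).
Proof.
move=> [pg gE].
under [RHS]eq_bigr => k _.
  rewrite (positive_form_sumr pg).
  under eq_bigr => i _ do rewrite (positive_form_suml pg).
  over.
rewrite [RHS]exchange_big; apply: eq_bigr => i _ /=.
rewrite [RHS]exchange_big; apply: eq_bigr => j _ /=.
rewrite linear_sum (linear_fun_sum (L2_rep_linear (xi j))).
rewrite (positive_form_suml hdot_positive).
by apply: eq_bigr => k _; rewrite gE.
Qed.

End CompletelyPositiveForms.

Theorem proposition3p8 (R : realType) (M N : vonNeumannType R)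
    (L2 : standard_form N) (T : alg_tensor M L2)
    (Phi1 Psi1 Phi2 Psi2 : {linear M -> N})
    (cpPhi1 : completely_positive Phi1) (cpPsi1 : completely_positive Psi1)
    (cpPhi2 : completely_positive Phi2) (cpPsi2 : completely_positive Psi2)
    (Theta1 Theta2 Theta : {linear M -> N})
    (Theta1E : is_cp_gmean T Phi1 Psi1 Theta1)
    (Theta2E : is_cp_gmean T Phi2 Psi2 Theta2)
    (ThetaE : is_cp_gmean T (Phi1 \+ Phi2) (Psi1 \+ Psi2) Theta) :
  le_cp (Theta1 \+ Theta2) Theta.
Proof.
have [_ [s1 [t1 [g1 [s1P t1P g1P Theta1g]]]]] := Theta1E.
have [_ [s2 [t2 [g2 [s2P t2P g2P Theta2g]]]]] := Theta2E.
have [_ [s [t [g [sP tP gP Thetag]]]]] := ThetaE.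
have g_ge z : g1 z z + g2 z z <= g z z.
  apply: (form_gmean_superadditive g1P g2P gP) => w.
    by rewrite (is_cp_form_unique sP (is_cp_formD s1P s2P)).
  by rewrite (is_cp_form_unique tP (is_cp_formD t1P t2P)).
(* The geometric means of the forms are themselves the forms of [Theta], [Theta1] and [Theta2], so
   [cp_form_sum] applies to all three. *)
have gE := conj (form_gmean_positive gP) (fun x y u v => esym (Thetag x y u v)).
have g1E := conj (form_gmean_positive g1P) (fun x y u v => esym (Theta1g x y u v)).
have g2E := conj (form_gmean_positive g2P) (fun x y u v => esym (Theta2g x y u v)).
move=> n _ [Y ->]; apply: (von_neumann_rep_positive_mx (L2_von_neumann_rep L2)).
move=> xi; pose v k := \sum_j tensor T (Y k j) (xi j).
set lhs := \sum_i _.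
(* Row by row, the quadratic form of the difference is the defect of superadditivity at [v k], which
   [g_ge] makes nonnegative. *)
suff -> : lhs = \sum_k (g (v k) (v k) - (g1 (v k) (v k) + g2 (v k) (v k))).
  by apply: sumr_ge0 => k _; rewrite subr_ge0.
rewrite sumrB big_split /= -(cp_form_sum _ _ gE) -(cp_form_sum _ _ g1E).
rewrite -(cp_form_sum _ _ g2E) -big_split -sumrB.
apply: eq_bigr => i _; rewrite -big_split -sumrB; apply: eq_bigr => j _.
rewrite !mxE /= (linear_funB (L2_rep_linear _)) hdotBl.
by rewrite (linear_funD (L2_rep_linear _)) hdotDl.
Qed.
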